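(* Let $m\ge 0$ and $n\ge 0$ be integers. Then $u(m,n)$ equals the number of partitions $\lambda$ of $n$ satisfying all three of the following conditions: (1) $\mathrm{rank}(\lambda)\le -m-1$ if $m\ge 1$, and $\mathrm{rank}(\lambda)\le 0$ if $m=0$; (2) $m-1$ belongs to the rank-set of $\lambda$; (3) if $m\ge 2$, then $\lambda_1>\lambda_2>\cdots>\lambda_m$.
   Context: A strongly unimodal sequence of weight $n$ is a finite sequence of positive integers $(a_1,\ldots,a_\ell)$ such that, for some $k$ with $1\le k\le\ell$, $$a_1<\cdots<a_{k-1}<a_k>a_{k+1}>\cdots>a_\ell\ge 1,$$ and $\sum_i a_i=n$. Its rank is $\ell-2k+1$. $u(m,n)$ is the number of strongly unimodal sequences of weight $n$ and rank $m$. A partition $\lambda=(\lambda_1\ge\lambda_2\ge\cdots\ge\lambda_{\ell(\lambda)}\ge 1)$ has length $\ell(\lambda)$. By convention $\lambda_k=0$ for $k>\ell(\lambda)$. Dyson's rank is $\mathrm{rank}(\lambda)=\lambda_1-\ell(\lambda)$. The rank-set of $\lambda$ is the infinite strictly increasing sequence $$(-\lambda_1,\,1-\lambda_2,\,2-\lambda_3,\ldots,\,j-\lambda_{j+1},\ldots),$$ that is, the set $\{j-\lambda_{j+1}: j\ge 0\}$. It equals $(-\lambda_1,\ldots,\ell(\lambda)-1-\lambda_{\ell(\lambda)},\ell(\lambda),\ell(\lambda)+1,\ldots)$. *)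

(* Defs.v *)
From mathcomp Require Import all_boot all_order all_algebra.
From mathcomp Require Import finmap zify boolp classical_sets functions cardinality.

Set Implicit Arguments.
Unset Strict Implicit.
Unset Printing Implicit Defensive.

Import Order.TTheory GRing.Theory Num.Theory.
Local Open Scope classical_set_scope.
Local Open Scope ring_scope.

Definition composition (n : nat) (s : seq nat) : Prop :=
  all (ltn 0) s /\ sumn s = n.

(* The cardinal of a set of sequences is taken with fset_set, which is the empty
   set on infinite sets; the sets counted here consist of compositions of n. *)
Lemma finite_composition (n : nat) : finite_set (composition n : set (seq nat)).
Proof.
apply: (@sub_finite_set _ _
  (range (fun b : n.-bseq 'I_n.+1 => [seq val i | i <- b]))); last first.
  exact/finite_image/finite_finset.
move=> s [s_gt0 <-].
have s_size : (size s <= sumn s)%N.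
  elim: s s_gt0 => //= x s IHs /andP[x_gt0 /IHs]; lia.
have s_le : all (fun x => x <= sumn s)%N s.
  apply/allP => x; elim: (s) => //= y t IHt; rewrite inE => /orP[/eqP->|/IHt]; lia.
have b_size : (size [seq inord x : 'I_(sumn s).+1 | x <- s] <= sumn s)%N.
  by rewrite size_map.
exists (Bseq b_size) => //=; rewrite -map_comp -[RHS]map_id.
by apply/eq_in_map => x /(allP s_le) x_le /=; rewrite inordK.
Qed.

(* a = (a_1, ..., a_l) with a_1 < ... < a_k > ... > a_l; the position k is
   counted from 1, so that a_k is both the last element of take k a and the
   first element of drop k.-1 a. *)
Definition peak (k : nat) (a : seq nat) : Prop :=
  [/\ (1 <= k <= size a)%N, sorted ltn (take k a) & sorted gtn (drop k.-1 a)].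

(* Hence the rank below depends only on the sequence. *)
Lemma peak_uniq (a : seq nat) (k k' : nat) : peak k a -> peak k' a -> k = k'.
Proof.
wlog suff lt_absurd : k k' / peak k a -> peak k' a -> (k < k')%N -> False.
  move=> pk pk'; case: (ltngtP k k') => // lt_kk'.
    by case: (lt_absurd k k').
  by case: (lt_absurd k' k).
move=> [/andP[k_gt0 _] _ kdec] [/andP[_ k'_le] k'inc _] lt_kk'.
have ltn_tr : transitive ltn by exact: ltn_trans.
have gtn_tr : transitive gtn by move=> y x z /= yx zy; exact: ltn_trans yx.
have size_take' : size (take k' a) = k' by rewrite size_takel.
have := sorted_ltn_nth ltn_tr 0%N k'inc k.-1 k.
rewrite !inE size_take' !nth_take; try lia.
move=> /(_ ltac:(lia) lt_kk' ltac:(lia)) /= up.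
have := sorted_ltn_nth gtn_tr 0%N kdec 0%N 1%N.
rewrite !inE size_drop !nth_drop addn0 addn1 prednK //.
move=> /(_ ltac:(lia) ltac:(lia) isT) /=; lia.
Qed.

Definition unimodal_with_rank (m : int) (a : seq nat) : Prop :=
  exists2 k : nat, peak k a & (size a)%:Z - 2 * k%:Z + 1 = m.

Definition u (m : int) (n : nat) : nat :=
  #|` fset_set [set a : seq nat | composition n a /\ unimodal_with_rank m a]|.

Definition partition_of (n : nat) (l : seq nat) : Prop :=
  composition n l /\ sorted geq l.

(* The k-th part, counted from 1; it is 0 for k > size l. *)
Definition part (l : seq nat) (k : nat) : nat := nth 0%N l k.-1.

Definition dyson_rank (l : seq nat) : int := (part l 1)%:Z - (size l)%:Z.

Definition rank_set (l : seq nat) : set int :=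
  range (fun j : nat => j%:Z - (part l j.+1)%:Z).

(* Main.v *)
(* Let [t] be the position of the peak of a strongly unimodal sequence of rank
   [m >= 0], let C_0 > ... > C_(t-1) be its first [t] terms read backwards from
   the peak and R_0 > ... > R_(m+t-2) the terms after the peak.  Take
   R_0, ..., R_(m-1) as the first [m] rows of a partition and put below them the
   partition with Frobenius symbol
     (R_m, ..., R_(m+t-2), 0 | C_0 - 1, ..., C_(t-1) - 1).
   The final arm 0 says that row [m+t] has length exactly [t], which is the
   condition that [m-1] is in the rank-set; this also determines [t].  The
   inequality R_0 < C_0 becomes the condition on Dyson's rank, and the strict
   decrease of R becomes the distinctness of the first [m] rows. *)

Require Import Defs.
From mathcomp Require Import all_boot all_order all_algebra.
From mathcomp Require Import finmap boolp classical_sets functions cardinality.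
From mathcomp Require Import zify.

Set Implicit Arguments.
Unset Strict Implicit.

Import Order.TTheory GRing.Theory Num.Theory.

(** * Decreasing sequences padded with zeros *)

(** The last index is included: there the default 0 makes the last entry positive. *)
Definition strictly_decreasing (s : seq nat) : Prop :=
  forall i, i < size s -> nth 0 s i.+1 < nth 0 s i.

Definition weakly_decreasing (s : seq nat) : Prop :=
  forall i, nth 0 s i.+1 <= nth 0 s i.

Lemma strictly_decreasingP (s : seq nat) :
  strictly_decreasing s <-> all (ltn 0) s /\ sorted gtn s.
Proof.
split=> [s_decr | [/all_nthP s_gt0 /(sortedP 0) s_sorted] i lt_is].
  split; first by apply/(all_nthP 0) => i /s_decr /=; lia.
  by apply/(sortedP 0) => i lt_is; apply: s_decr; lia.
have [lt_iS | ge_iS] := ltnP i.+1 (size s); first exact: s_sorted.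
by rewrite (nth_default _ ge_iS); exact: s_gt0.
Qed.

Lemma weakly_decreasingP (s : seq nat) : weakly_decreasing s <-> sorted geq s.
Proof.
split=> [s_decr | /(sortedP 0) s_sorted i].
  by apply/(sortedP 0) => i _; exact: s_decr.
have [lt_iS | ge_iS] := ltnP i.+1 (size s); first exact: s_sorted.
by rewrite (nth_default _ ge_iS).
Qed.

Lemma weakly_decreasing_nth (s : seq nat) (i j : nat) :
  weakly_decreasing s -> i <= j -> nth 0 s j <= nth 0 s i.
Proof.
move=> s_decr /subnKC <-; elim: (j - i) => [|k IHk]; first by rewrite addn0.
by rewrite addnS; exact: leq_trans (s_decr _) IHk.
Qed.

(** From index [i] on there are [size s - i] distinct positive entries, of which entry [i] is the
    largest. *)
Lemma strictly_decreasing_ge (s : seq nat) (i : nat) :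
  strictly_decreasing s -> size s <= nth 0 s i + i.
Proof.
move=> s_decr; have [le_si | lt_is] := leqP (size s) i; first by lia.
have [k] := ubnP (size s - i); elim: k i lt_is => // k IHk i lt_is le_k.
have := s_decr _ lt_is.
have [lt_iS | ge_iS] := ltnP i.+1 (size s); last by lia.
by have := IHk i.+1 lt_iS ltac:(lia); lia.
Qed.

(** * Sums and conjugate partitions *)

Lemma sumn_mkseq (f : nat -> nat) (n : nat) :
  sumn (mkseq f n) = \sum_(i < n) f i.
Proof. by rewrite sumnE big_map -(big_mkord xpredT) /index_iota subn0. Qed.

Lemma sumn_nth (s : seq nat) : sumn s = \sum_(i < size s) nth 0 s i.
Proof. by rewrite -sumn_mkseq mkseq_nth. Qed.

Lemma sum_ltn_ord (n x : nat) : \sum_(j < n) (j < x) = minn x n.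
Proof. by elim: n => [|n IHn]; rewrite ?big_ord0 ?big_ord_recr /= ?IHn; lia. Qed.

(* For a weakly decreasing [s] with entries at most [n], this is the conjugate
   partition padded with zeros to length [n]. *)
Definition conj_seq (n : nat) (s : seq nat) : seq nat :=
  mkseq (fun j => count (ltn j) s) n.

Lemma sumn_conj_seq (n : nat) (s : seq nat) :
  all (geq n) s -> sumn (conj_seq n s) = sumn s.
Proof.
rewrite sumn_mkseq; elim: s => [|x s IHs] /= => [_ | /andP[le_xn /IHs <-]].
  by rewrite big1.
by rewrite big_split /= sum_ltn_ord (minn_idPl le_xn).
Qed.

(** The entries exceeding [j] form an initial segment, so column [j] reaches row [i] exactly when
    row [i] reaches column [j]. *)
Lemma ltn_count_ltn (s : seq nat) (i j : nat) :
  weakly_decreasing s -> (i < count (ltn j) s) = (j < nth 0 s i).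
Proof.
elim: s i => [|x s IHs] i s_decr; first by rewrite nth_nil.
have s_decr' : weakly_decreasing s by move=> k; exact: s_decr k.+1.
have le_x := s_decr 0; have IH0 := IHs 0 s_decr'.
by case: i => [|i] /=; rewrite /= in le_x; [|have := IHs i s_decr']; lia.
Qed.

Lemma conj_seqK (n : nat) (s : seq nat) :
  weakly_decreasing s -> nth 0 s 0 <= n -> conj_seq (size s) (conj_seq n s) = s.
Proof.
move=> s_decr le_n; apply: (@eq_from_nth _ 0); rewrite size_mkseq // => i lt_is.
rewrite nth_mkseq // count_map (eq_count (a2 := fun j => j < nth 0 s i)); last first.
  by move=> j /=; exact: ltn_count_ltn.
rewrite -sumn_count -/(mkseq _ n) sumn_mkseq sum_ltn_ord.
by have := weakly_decreasing_nth s_decr (leq0n i); lia.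
Qed.

Lemma weakly_decreasing_conj_seq (n : nat) (s : seq nat) :
  weakly_decreasing (conj_seq n s).
Proof.
move=> i; have [lt_in | ge_in] := ltnP i.+1 n; last first.
  by rewrite nth_default // size_mkseq.
rewrite !nth_mkseq //; last by lia.
by apply: sub_count => x /=; lia.
Qed.

(** * Unimodal sequences as pairs of decreasing sequences *)

(* The sequence is [rev C ++ R], with its peak at the head of [C]. *)
Definition peak_data (m : nat) (C R : seq nat) : Prop :=
  [/\ strictly_decreasing C, strictly_decreasing R, nth 0 R 0 < nth 0 C 0 &
      (size R).+1 = m + size C].

Lemma unimodal_peak_data (n m : nat) (a : seq nat) :
  composition n a /\ unimodal_with_rank m%:Z a <->
  exists C R : seq nat, [/\ a = rev C ++ R, peak_data m C R & sumn C + sumn R = n].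
Proof.
split.
  case=> [[a_gt0 a_sum] [[|k] [// /andP[_ lt_ka] up /= down] rk]].
  have all_gt0 : all (ltn 0) (take k.+1 a) /\ all (ltn 0) (drop k.+1 a).
    by apply/andP; rewrite -all_cat cat_take_drop.
  rewrite (drop_nth 0 lt_ka) in down.
  exists (rev (take k.+1 a)), (drop k.+1 a); split; last 1 first.
  - by rewrite sumn_rev -sumn_cat cat_take_drop.
  - by rewrite revK cat_take_drop.
  split.
  - by apply/strictly_decreasingP; rewrite all_rev rev_sorted; case: all_gt0.
  - by apply/strictly_decreasingP; split; [case: all_gt0 | exact: path_sorted down].
  - have a_k : 0 < nth 0 a k by exact: (all_nthP 0 a_gt0).
    rewrite nth_rev size_takel // subn1 nth_take //=.
    by case: (drop _ _) down => //= y s /andP[].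
  - by rewrite size_rev size_drop size_takel //; lia.
move=> [C [R [-> [/strictly_decreasingP[C_gt0 C_sorted] /strictly_decreasingP[R_gt0 R_sorted] lt_RC size_R] <-]]].
have C_nil : 0 < size C by case: (C) lt_RC.
split; first by split; rewrite ?sumn_cat ?sumn_rev // all_cat all_rev C_gt0.
exists (size C); last by rewrite size_cat size_rev; lia.
split; first by rewrite size_cat size_rev; lia.
  by rewrite take_size_cat ?size_rev // rev_sorted.
case: C lt_RC C_nil {C_gt0 C_sorted size_R} => //= x C lt_RC _.
rewrite rev_cons cat_rcons drop_size_cat ?size_rev //=.
by case: R lt_RC R_sorted {R_gt0} => //= y R -> ->.
Qed.

(** * The two maps and the conditions on the partition *)

(* The first [m + t] rows, [t = size C], are explicit. The rows below them are
   the conjugate of the [t] columns of lengths [C_i + i], of which only the part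
   below the square of side [t] remains. *)
Definition peak_to_partition (m : nat) (C R : seq nat) : seq nat :=
  mkseq (fun i => nth 0 R i + (i.+1 - m)) (m + size C) ++
  conj_seq (nth 0 C 0 - size C)
    (mkseq (fun i => nth 0 C i + i - size C) (size C)).

(** Below the first [m] rows, column [i] consists of [t] cells in the square and those under it;
    removing the [i] cells above the diagonal leaves the leg plus one. *)
Definition partition_left (m t : nat) (l : seq nat) : seq nat :=
  mkseq (fun i => nth 0 (conj_seq t (drop (m + t) l)) i + t - i) t.

(** Truncated subtraction keeps the first [m] rows and reduces the later ones to their arms; the
    length [(m + t).-1] omits the final arm 0. *)
Definition partition_right (m t : nat) (l : seq nat) : seq nat :=
  mkseq (fun i => nth 0 l i - (i.+1 - m)) (m + t).-1.

(* The condition on the rank-set is [part l (m + t) = t], where [m + t - 1] is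
   the index that realizes [m - 1]. *)
Definition rank_data (m t : nat) (l : seq nat) : Prop :=
  [/\ all (ltn 0) l /\ weakly_decreasing l,
      0 < t /\ nth 0 l (m + t).-1 = t,
      nth 0 l 0 + m + (0 < m) <= size l &
      forall i, i.+1 < m -> nth 0 l i.+1 < nth 0 l i].

Lemma weakly_decreasing_excess (C : seq nat) : strictly_decreasing C ->
  weakly_decreasing (mkseq (fun i => nth 0 C i + i - size C) (size C)).
Proof.
move=> C_decr i; have [lt_i | ge_i] := ltnP i.+1 (size C); last first.
  by rewrite nth_default // size_mkseq.
rewrite !nth_mkseq //; last by lia.
by have := C_decr i ltac:(lia); lia.
Qed.

Lemma excess_le (C : seq nat) : strictly_decreasing C ->
  all (geq (nth 0 C 0 - size C))
    (mkseq (fun i => nth 0 C i + i - size C) (size C)).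
Proof.
move=> C_decr; apply/(all_nthP 0) => i; rewrite size_mkseq => lt_i.
have := weakly_decreasing_nth (weakly_decreasing_excess C_decr) (leq0n i).
by rewrite !nth_mkseq //= ?addn0; lia.
Qed.

(** Both sides count the cells on or below the diagonal: on the left by rows inside the square and
    by columns under it, on the right by columns only. *)
Lemma sum_excess (t : nat) (c : nat -> nat) : (forall i, i < t -> t <= c i + i) ->
  \sum_(i < t) i.+1 + \sum_(i < t) (c i + i - t) = \sum_(i < t) c i.
Proof.
move=> c_ge; rewrite -big_split /=.
apply/(@addnI (\sum_(i < t) i)).
(* Reversal turns [i] into [t - i.+1]; together with [i.+1] this makes up the subtracted [t], so the
   identity holds termwise. *)
rewrite {1}(reindex_inj rev_ord_inj) /= -!big_split /=.
by apply: eq_bigr => i _; have := c_ge i (ltn_ord i); have := ltn_ord i; lia.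
Qed.

(** * From unimodal sequences to partitions *)

Section PeakToPartition.

Context (m : nat) (C R : seq nat) (CR : peak_data m C R).

Lemma peak_size_gt0 : 0 < size C.
Proof. by case: CR => _ _; case: (C). Qed.

Lemma sumn_peak_to_partition :
  sumn (peak_to_partition m C R) = sumn C + sumn R.
Proof.
case: CR => C_decr R_decr lt_RC size_R.
(* The last index lies just past the end of [R] and contributes the default 0, the final arm. *)
have sum_R : \sum_(i < m + size C) nth 0 R i = sumn R.
  by rewrite -size_R big_ord_recr /= nth_default // addn0 -sumn_nth.
rewrite sumn_cat sumn_conj_seq ?excess_le // !sumn_mkseq big_split /= sum_R.
rewrite big_split_ord /= [X in _ + (X + _)]big1 ?add0n; last first.
  by move=> i _; have := ltn_ord i; lia.
under eq_bigr do rewrite -addnS addKn.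
rewrite -addnA sum_excess; first by rewrite -sumn_nth addnC.
by move=> i _; exact: strictly_decreasing_ge.
Qed.

Lemma size_peak_to_partition : size (peak_to_partition m C R) = m + nth 0 C 0.
Proof.
case: CR => C_decr _ _ _; rewrite size_cat !size_mkseq.
by have := strictly_decreasing_ge 0 C_decr; lia.
Qed.

Lemma nth_peak_to_partition (i : nat) : i < m + size C ->
  nth 0 (peak_to_partition m C R) i = nth 0 R i + (i.+1 - m).
Proof. by move=> lt_i; rewrite nth_cat size_mkseq lt_i nth_mkseq. Qed.

Lemma peak_to_partition_le (i : nat) : m + size C <= i ->
  nth 0 (peak_to_partition m C R) i.+1 <= nth 0 (peak_to_partition m C R) i.
Proof.
move=> le_i; rewrite !nth_cat size_mkseq ltnNge leqW // ltnNge le_i /= subSn //.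
exact: weakly_decreasing_conj_seq.
Qed.

Lemma peak_to_partition_data : rank_data m (size C) (peak_to_partition m C R).
Proof.
have t_gt0 := peak_size_gt0; case: CR => C_decr R_decr lt_RC size_R.
have C0_ge := strictly_decreasing_ge 0 C_decr.
have nthP := nth_peak_to_partition.
have last_t : nth 0 (peak_to_partition m C R) (m + size C).-1 = size C.
  by rewrite nthP ?nth_default; lia.
split => //.
- split; last first.
    move=> i; have [lt_iS | ] := ltnP i.+1 (m + size C).
      rewrite !nthP //; last by lia.
      by have := R_decr i ltac:(lia); lia.
    rewrite leq_eqVlt => /orP[/eqP def_i | lt_i]; last exact: peak_to_partition_le.
    (* At the junction, the first row under the square counts some of [size C] columns, hence is no
       longer than the row above. *)
    have -> : i = (m + size C).-1 by lia.
    rewrite last_t prednK; last by lia.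
    rewrite nth_cat size_mkseq ltnn subnn.
    have [lt_tC | ] := ltnP 0 (nth 0 C 0 - size C); last first.
      by move=> ?; rewrite nth_default // size_mkseq.
    by rewrite nth_mkseq // (leq_trans (count_size _ _)) // size_mkseq.
  rewrite all_cat; apply/andP; split; apply/(all_nthP 0) => i; rewrite size_mkseq => lt_i.
    rewrite nth_mkseq //=.
    have [lt_iR|] := ltnP i (size R); last by lia.
    by have := R_decr i lt_iR; lia.
  rewrite nth_mkseq //= ltn_count_ltn; last exact: weakly_decreasing_excess.
  by rewrite nth_mkseq // addn0.
(* The first row is [R_0] if [m > 0] and [R_0 + 1] if [m = 0], so both forms of the rank bound
   amount to [R_0 < C_0]. *)
- by rewrite size_peak_to_partition nthP; lia.
- by move=> i lt_i; rewrite !nthP; try lia; have := R_decr i ltac:(lia); lia.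
Qed.

Lemma peak_to_partitionK_right :
  partition_right m (size C) (peak_to_partition m C R) = R.
Proof.
case: CR => C_decr R_decr lt_RC size_R.
apply: (@eq_from_nth _ 0); rewrite size_mkseq ?size_R; first by lia.
by move=> i lt_i; rewrite nth_mkseq // nth_peak_to_partition; lia.
Qed.

Lemma peak_to_partitionK_left :
  partition_left m (size C) (peak_to_partition m C R) = C.
Proof.
case: CR => C_decr R_decr lt_RC size_R.
rewrite /partition_left drop_size_cat ?size_mkseq //.
apply: (@eq_from_nth _ 0); rewrite size_mkseq // => i lt_i.
rewrite nth_mkseq //.
set d := mkseq (fun i => nth 0 C i + i - size C) (size C).
have size_d : size d = size C by rewrite size_mkseq.
rewrite -{1}size_d conj_seqK; first last.
- by rewrite nth_mkseq ?addn0 //; lia.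
- exact: weakly_decreasing_excess.
by rewrite nth_mkseq //; have := strictly_decreasing_ge i C_decr; lia.
Qed.

End PeakToPartition.

(** * From partitions back to unimodal sequences *)

Section PartitionToPeak.

Context (m t : nat) (l : seq nat) (l_data : rank_data m t l).

Let l_decr : weakly_decreasing l. Proof. by case: l_data => [[]]. Qed.
Let l_gt0 : all (ltn 0) l. Proof. by case: l_data => [[]]. Qed.

Lemma partition_tail_decr : weakly_decreasing (drop (m + t) l).
Proof. by move=> i; rewrite !nth_drop addnS. Qed.

Lemma partition_tail_le : nth 0 (drop (m + t) l) 0 <= t.
Proof.
case: l_data => _ [t_gt0 def_t] _ _; rewrite nth_drop addn0 -{2}def_t.
by apply: weakly_decreasing_nth => //; lia.
Qed.

Lemma rank_data_size : m + t <= size l.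
Proof.
case: l_data => _ [t_gt0 def_t] _ _; have [|ge_l] := ltnP (m + t).-1 (size l); first by lia.
by rewrite nth_default // in def_t; lia.
Qed.

Lemma nth_partition_left0 : nth 0 (partition_left m t l) 0 = size l - m.
Proof.
case: l_data => _ [t_gt0 def_t] _ _.
rewrite !nth_mkseq // subn0.
have /eqP -> : count (ltn 0) (drop (m + t) l) == size (drop (m + t) l).
  rewrite -all_count; apply/(all_nthP 0) => i; rewrite size_drop nth_drop => lt_i.
  by apply: (all_nthP 0 l_gt0); lia.
by rewrite size_drop; have := rank_data_size; lia.
Qed.

Lemma partition_peak_data :
  peak_data m (partition_left m t l) (partition_right m t l).
Proof.
case: l_data => _ [t_gt0 def_t] l_size l_strict.
split; last by rewrite !size_mkseq; lia.
- move=> i; rewrite size_mkseq => lt_i.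
  have := @weakly_decreasing_conj_seq t (drop (m + t) l) i.
  rewrite [X in _ < X]nth_mkseq //.
  have [lt_iS | ge_iS] := ltnP i.+1 t; first by rewrite [X in X < _]nth_mkseq //; lia.
  by rewrite [X in X < _]nth_default ?size_mkseq //; lia.
- move=> i; rewrite size_mkseq => lt_i; rewrite [X in _ < X]nth_mkseq //.
  (* At most [t - 1] cells are removed from a row of at least [t], so the result is positive. *)
  have ge_t : t <= nth 0 l i by rewrite -def_t; apply: weakly_decreasing_nth => //; lia.
  have [lt_iS | ge_iS] := ltnP i.+1 (m + t).-1; last first.
    by rewrite nth_default ?size_mkseq //; lia.
  rewrite nth_mkseq //; have := l_decr i; have := l_strict i.
  have ge_t' : t <= nth 0 l i.+1 by rewrite -def_t; apply: weakly_decreasing_nth => //; lia.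
  (* Within the first [m] rows the decrease is distinctness; from there on the number of removed
     cells grows by one per row. *)
  by have [lt_m _ _| ge_m _] := ltnP i.+1 m; [have := l_strict i lt_m|]; lia.
- rewrite nth_partition_left0; have := rank_data_size.
  have [lt_0 | ge_0] := ltnP 0 (m + t).-1; first by rewrite nth_mkseq //; lia.
  by rewrite nth_default ?size_mkseq //; lia.
Qed.

Lemma partition_to_peakK :
  peak_to_partition m (partition_left m t l) (partition_right m t l) = l.
Proof.
case: (l_data) => _ [t_gt0 def_t] _ _; have size_l := rank_data_size.
rewrite /peak_to_partition nth_partition_left0 size_mkseq.
rewrite -[RHS](cat_take_drop (m + t)); congr cat.
  apply: (@eq_from_nth _ 0); rewrite size_mkseq ?size_takel // => i lt_i.
  rewrite nth_mkseq // nth_take //.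
  have ge_t : t <= nth 0 l i by rewrite -def_t; apply: weakly_decreasing_nth => //; lia.
  have [lt_iS | ge_iS] := ltnP i (m + t).-1; first by rewrite nth_mkseq //; lia.
  rewrite nth_default ?size_mkseq //; have -> : i = (m + t).-1 by lia.
  by rewrite def_t; lia.
have -> : size l - m - t = size (drop (m + t) l) by rewrite size_drop subnDA.
rewrite -[RHS](conj_seqK partition_tail_decr partition_tail_le); congr conj_seq.
apply: (@eq_from_nth _ 0); rewrite !size_mkseq // => i lt_i.
by rewrite nth_mkseq // [X in X + i - t]nth_mkseq //; lia.
Qed.

End PartitionToPeak.

(** * Rank, rank-set and the side of the square *)

(** A larger [t] would be the length of a lower row, against weak decrease. *)
Lemma rank_data_uniq (m t t' : nat) (l : seq nat) :
  rank_data m t l -> rank_data m t' l -> t = t'.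
Proof.
move=> [[_ l_decr] [t_gt0 def_t] _ _] [_ [t'_gt0 def_t'] _ _].
have [le_tt' | /ltnW le_t't] := leqP t t'.
  by have := weakly_decreasing_nth (i := (m + t).-1) (j := (m + t').-1) l_decr; lia.
by have := weakly_decreasing_nth (i := (m + t').-1) (j := (m + t).-1) l_decr; lia.
Qed.

Lemma rank_dataP (n m : nat) (l : seq nat) :
  (exists2 t, rank_data m t l & sumn l = n) <->
  [/\ partition_of n l,
      ((1 <= m)%N -> (dyson_rank l <= - m%:Z - 1)%R) /\
        (m = 0%N -> (dyson_rank l <= 0)%R),
      rank_set l (m%:Z - 1)%R &
      (2 <= m)%N ->
        forall i : nat, (1 <= i < m)%N -> (part l i.+1 < part l i)%N].
Proof.
rewrite /partition_of /composition /dyson_rank /rank_set /part /=.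
split.
  move=> [t [[l_gt0 /weakly_decreasingP l_sorted] [t_gt0 def_t] l_rank l_strict] l_sum].
  split=> //; first by split; lia.
    by exists (m + t).-1 => //=; rewrite def_t; lia.
  by move=> _ [|i] // /andP[_ lt_im]; exact: l_strict.
move=> [[[l_gt0 l_sum] /weakly_decreasingP l_decr] [rank_m rank_0] [j _ def_j] l_strict].
have l_size : nth 0 l 0 + m + (0 < m) <= size l.
  by case: (posnP m) => m0; [move: (rank_0 m0) | move: (rank_m m0)]; lia.
(* An empty row [j] would force [j = m - 1], but [l_size] gives at least [m] nonempty rows. *)
have t_gt0 : 0 < nth 0 l j.
  have [lt_j | ge_j] := ltnP j (size l); first exact: (all_nthP 0 l_gt0).
  by rewrite nth_default // in def_j; case: (l) l_size ge_j => /=; lia.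
exists (nth 0 l j) => //; split=> //.
  by split=> //; congr nth; rewrite /= in def_j *; lia.
move=> i lt_i; exact: (l_strict ltac:(lia) i.+1).
Qed.

(** * The bijection and the count *)

(** The length is [m + 2t - 1], which yields the peak position [t]. *)
Definition unimodal_to_partition (m : nat) (a : seq nat) : seq nat :=
  let t := (size a - m).+1./2 in
  peak_to_partition m (rev (take t a)) (drop t a).

Lemma unimodal_to_partitionE (m : nat) (C R : seq nat) : peak_data m C R ->
  unimodal_to_partition m (rev C ++ R) = peak_to_partition m C R.
Proof.
move=> CR; have t_gt0 := peak_size_gt0 CR; case: CR => _ _ _ size_R.
rewrite /unimodal_to_partition size_cat size_rev.
have -> : (size C + size R - m).+1./2 = size C by lia.
by rewrite take_size_cat ?drop_size_cat ?size_rev // revK.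
Qed.

Local Open Scope classical_set_scope.

Lemma image_unimodal_to_partition (n m : nat) :
  unimodal_to_partition m @`
    [set a : seq nat | composition n a /\ unimodal_with_rank m%:Z a] =
  [set l | exists2 t, rank_data m t l & sumn l = n].
Proof.
apply/seteqP; split=> [_ [_ /unimodal_peak_data[C [R [-> CR CR_sum]]] <-] | l [t l_data l_sum]] /=.
  rewrite unimodal_to_partitionE //; exists (size C); first exact: peak_to_partition_data.
  by rewrite sumn_peak_to_partition.
have CR := partition_peak_data l_data.
exists (rev (partition_left m t l) ++ partition_right m t l).
  apply/unimodal_peak_data; do 2!eexists; split=> //.
  by rewrite -(sumn_peak_to_partition CR) partition_to_peakK.
by rewrite unimodal_to_partitionE // partition_to_peakK.
Qed.

Lemma unimodal_to_partition_inj (n m : nat) :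
  set_inj [set a : seq nat | composition n a /\ unimodal_with_rank m%:Z a]
    (unimodal_to_partition m).
Proof.
move=> a a' /set_mem /unimodal_peak_data[C [R [-> CR _]]].
move=> /set_mem /unimodal_peak_data[C' [R' [-> CR' _]]].
rewrite !unimodal_to_partitionE // => eq_l.
(* The image determines [t], and then the inverse maps recover [C] and [R]. *)
have size_C : size C = size C'.
  apply: rank_data_uniq (peak_to_partition_data CR) _.
  by rewrite eq_l; exact: peak_to_partition_data.
congr (rev _ ++ _).
  by rewrite -(peak_to_partitionK_left CR) size_C eq_l peak_to_partitionK_left.
by rewrite -(peak_to_partitionK_right CR) size_C eq_l peak_to_partitionK_right.
Qed.

Local Open Scope ring_scope.

Theorem theorem1p4 (m n : nat) :
  u m%:Z n =
  #|` fset_set [set l : seq nat |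
        [/\ partition_of n l,
            ((1 <= m)%N -> dyson_rank l <= - m%:Z - 1) /\
              (m = 0%N -> dyson_rank l <= 0),
            rank_set l (m%:Z - 1) &
            (2 <= m)%N ->
              forall i : nat, (1 <= i < m)%N -> (part l i.+1 < part l i)%N]]|.
Proof.
rewrite /u; set A := [set a | _].
have A_fin : finite_set A by apply: sub_finite_set (finite_composition n) => a [].
transitivity #|` fset_set (unimodal_to_partition m @` A)|; last first.
  rewrite image_unimodal_to_partition; congr (#|` fset_set _|).
  by apply/seteqP; split=> l /rank_dataP.
rewrite fset_set_image // card_in_imfset //= => a a'.
by rewrite !in_fset_set //; exact: unimodal_to_partition_inj.
Qed.
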